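(* Let $T$ be a local domain with maximal ideal $\mathfrak{m}$ and residue field $\kappa := T/\mathfrak{m}$, and let $B$ be an integral domain having quotient field $\kappa$. Let $\phi: T \to \kappa$ be the canonical surjective map and let $D := \phi^{-1}(B)$. Then the integral domain $D$ is maximal excluding if and only if $B$ is maximal excluding and $T$ is a valuation domain.
   Context: An overring of an integral domain $D$ with quotient field $\mathcal{Q}(D)$ is an integral domain $A$ with $D \subseteq A \subseteq \mathcal{Q}(D)$. An integral domain $D$ is called a maximal excluding domain if there is an element $\alpha \in \mathcal{Q}(D)\setminus D$ such that $D$ is maximal (with respect to inclusion) among its overrings not containing $\alpha$, i.e. every overring of $D$ strictly containing $D$ contains $\alpha$. ''Local'' means having a unique maximal ideal (no noetherian hypothesis).
   Formalization: It is additionally assumed that B is not equal to κ (B is not a field); without this the claim fails, e.g. T = Z_(p), B = κ = F_p, where D = T is maximal excluding (α = 1/p) but the field B is not. *)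

(* Defs.v *)
From HB Require Import structures.
From mathcomp Require Export all_boot all_algebra.
From mathcomp Require Export boolp classical_sets.

Set Implicit Arguments.
Unset Strict Implicit.
Unset Printing Implicit Defensive.

Import GRing.Theory.
Open Scope ring_scope.
Open Scope classical_set_scope.

(* [idealr R] is MathComp's type of proper ideals ([1 \notin m] is part of the
   structure), so maximality only has to compare [m] with other proper ideals. *)
Definition maximal_ideal (R : comNzRingType) (m : idealr R) : Prop :=
  forall J : idealr R, {subset m <= J} -> {subset J <= m}.

Definition local_ring (R : comNzRingType) (m : idealr R) : Prop :=
  maximal_ideal m /\ (forall J : idealr R, maximal_ideal J -> J =i m).

(* The quotient ring [{ideal_quot m}], tagged with a proof that [m] is maximal
   so that it can carry a canonical [fieldType] structure. *)
Definition residue_field (R : comNzRingType) (m : idealr R)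
  (_ : maximal_ideal m) : Type := {ideal_quot m}.

Section ResidueField.
Variables (R : comNzRingType) (m : idealr R) (mmax : maximal_ideal m).
Local Notation kappa := (residue_field mmax).

HB.instance Definition _ := GRing.ComNzRing.on kappa.

Definition residue (x : R) : kappa := \pi_{ideal_quot m}%qT x.

Lemma residue_is_zmod_morphism : zmod_morphism residue.
Proof. by move=> x y; rewrite /residue rmorphB. Qed.

Lemma residue_is_monoid_morphism : monoid_morphism residue.
Proof. by split=> [|x y]; rewrite /residue ?rmorph1 ?rmorphM. Qed.

HB.instance Definition _ :=
  GRing.isZmodMorphism.Build R kappa residue residue_is_zmod_morphism.
HB.instance Definition _ :=
  GRing.isMonoidMorphism.Build R kappa residue residue_is_monoid_morphism.

Lemma residue_surj (x : kappa) : exists a, residue a = x.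
Proof. by exists (generic_quotient.repr (x : {ideal_quot m})); exact: reprK. Qed.

Lemma residue_eq0 (a : R) : (residue a == 0) = (a \in m).
Proof.
rewrite -[0](rmorph0 residue) -[X in _ = (X \in m)]subr0.
exact: esym (Quotient.idealrBE _ _ _).
Qed.

Lemma residue_inv_exists (x : kappa) : exists y, x != 0 -> y * x = 1.
Proof.
have [->|x0] := eqVneq x 0; first by exists 0.
apply: contrapT => noinv.
have [a ax] := residue_surj x.
pose J : {pred R} := [pred z | `[< exists c, z - c * a \in m >]].
have JP z : reflect (exists c, z - c * a \in m) (z \in J) by exact: asboolP.
have Jideal : idealr_closed J.
  split=> [||c u v].
  - by apply/JP; exists 0; rewrite mul0r subr0 idealr0.
  - apply/JP => -[c]; rewrite -residue_eq0 rmorphB rmorph1 rmorphM /= ax subr_eq0 eq_sym.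
    by move=> /eqP cx; apply: noinv; exists (residue c) => _; rewrite cx.
  - move=> /JP[d ud] /JP[e ve]; apply/JP; exists (c * d + e).
    have -> : c * u + v - (c * d + e) * a = c * (u - d * a) + (v - e * a).
      by rewrite mulrDl mulrBr mulrA opprD addrACA.
    by rewrite rpredD // idealMr.
pose Jm := isIdealr.Build R J Jideal.
pose JI : idealr R := HB.pack J Jm.
have /(_ a) : {subset JI <= m}.
  by apply: mmax => z zm; apply/JP; exists 0; rewrite mul0r subr0.
have aJ : a \in JI by apply/JP; exists 1; rewrite mul1r subrr idealr0.
by move=> /(_ aJ); rewrite -residue_eq0 ax (negPf x0).
Qed.

Definition residue_inv (x : kappa) : kappa :=
  if x == 0 then 0 else sval (cid (residue_inv_exists x)).

Lemma residue_mulVf (x : kappa) : x != 0 -> residue_inv x * x = 1.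
Proof.
move=> x0; rewrite /residue_inv; case: (cid _) => y /= /(_ x0) yx.
by rewrite (negPf x0).
Qed.

Lemma residue_inv0 : residue_inv 0 = 0.
Proof. by rewrite /residue_inv; case: (cid _) => y /= _; rewrite eqxx. Qed.

HB.instance Definition _ :=
  GRing.ComNzRing_isField.Build kappa residue_mulVf residue_inv0.

End ResidueField.

(* From here on an integral domain is given as a subring of a field [K], and
   its quotient field is the subfield of [K] formed by its fractions. *)
Definition subring (K : fieldType) (D : set K) : Prop := subring_closed (mem D).

Definition quotient_field (K : fieldType) (D : set K) : set K :=
  [set x | exists a b, [/\ D a, D b, b != 0 & x = a / b]].

Definition overring (K : fieldType) (D A : set K) : Prop :=
  [/\ subring A, D `<=` A & A `<=` quotient_field D].

Definition maximal_excluding (K : fieldType) (D : set K) : Prop :=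
  exists2 alpha : K, (quotient_field D `\` D) alpha &
    forall A : set K, overring D A -> D `<` A -> A alpha.

Definition valuation_domain (T : idomainType) : Prop :=
  forall x : {fraction T}, x != 0 ->
    range (@tofrac T) x \/ range (@tofrac T) x^-1.

(* Main.v *)
(* Let m be the maximal ideal of T, and identify T with its image in its quotient
   field K, which is also the quotient field of D.

   If T is a valuation domain, an overring of D that is not contained in T
   contains the inverse of an element of m, hence contains T; an overring
   contained in T is the preimage of an overring of B.

   Conversely let alpha be the element excluded by D. It lies in T, its residue
   beta is excluded by B, and beta is not in B. Suppose that x and x^-1 are both
   outside T. As in the proof that maximal local rings for domination are
   valuation rings, one may assume that 1 is not in m T[x]. Then D + m T[x] does
   not contain alpha, because alpha minus an element of D is a unit of T; so
   D + m T[x] = D, which forces m x to be contained in m. Thus m is an ideal of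
   T[x], and T[x]/m is generated over kappa by an element y outside kappa. For a
   suitable nonzero c in B the ring B[c y] does not contain beta, and its preimage
   in T[x] is an overring of D that contains D strictly and omits alpha, a
   contradiction. *)
From HB Require Import structures.
Require Import Defs.
From mathcomp Require Import ring.

Set Implicit Arguments.
Unset Strict Implicit.
Unset Printing Implicit Defensive.

Import GRing.Theory.
Local Open Scope ring_scope.
Local Open Scope classical_set_scope.

(** * Subrings and ring morphisms *)

Lemma subring_closedP (R : nzRingType) (A : set R) :
  subring_closed (mem A) <->
  [/\ A 1, forall x y, A x -> A y -> A (x - y) &
           forall x y, A x -> A y -> A (x * y)].
Proof.
split=> -[A1 AB AM]; split.
- by move: A1; rewrite in_setE.
- by move=> x y Ax Ay; have := AB x y; rewrite !in_setE; apply.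
- by move=> x y Ax Ay; have := AM x y; rewrite !in_setE; apply.
- by rewrite in_setE.
- by move=> x y; rewrite !in_setE; exact: AB.
- by move=> x y; rewrite !in_setE; exact: AM.
Qed.

Lemma subring_image (R S : nzRingType) (f : {rmorphism R -> S}) (A : set R) :
  subring_closed (mem A) -> subring_closed (mem (f @` A)).
Proof.
move=> /subring_closedP[A1 AB AM]; apply/subring_closedP; split.
- by exists 1; rewrite ?rmorph1.
- by move=> _ _ [x Ax <-] [y Ay <-]; exists (x - y); rewrite ?rmorphB //; exact: AB.
- by move=> _ _ [x Ax <-] [y Ay <-]; exists (x * y); rewrite ?rmorphM //; exact: AM.
Qed.

Lemma subring_preimage (R S : nzRingType) (f : {rmorphism R -> S}) (A : set S) :
  subring_closed (mem A) -> subring_closed (mem (f @^-1` A)).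
Proof.
move=> /subring_closedP[A1 AB AM]; apply/subring_closedP; split.
- by rewrite /= rmorph1.
- by move=> x y Ax Ay; rewrite /= rmorphB; exact: AB.
- by move=> x y Ax Ay; rewrite /= rmorphM; exact: AM.
Qed.

(** * Polynomials with coefficients in a subring *)

Lemma coef_comp_scaleX (R : comNzRingType) (c : R) (p : {poly R}) i :
  (p \Po (c *: 'X))`_i = c ^+ i * p`_i.
Proof.
have -> : p \Po (c *: 'X) = \poly_(i < size p) (c ^+ i * p`_i).
  rewrite comp_polyE poly_def; apply: eq_bigr => j _.
  by rewrite exprZn scalerA mulrC.
by rewrite coef_poly; case: ltnP => // pi; rewrite nth_default ?mulr0.
Qed.

(** Long division by a monic polynomial inverts no coefficient, so it never leaves [S]. *)
Lemma polyOver_monic_rem (R : comNzRingType) (S : subringClosed R)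
    (h f : {poly R}) :
  h \is monic -> h \is a polyOver S -> f \is a polyOver S ->
  exists q r, [/\ f = q * h + r, r \is a polyOver S & (size r < size h)%N].
Proof.
move=> hm hS; have [n] := ubnP (size f); elim: n f => // n IHn f.
rewrite ltnS => fn fS; have [fh|hf] := ltnP (size f) (size h).
  by exists 0, f; rewrite mul0r add0r.
have [f0|f0] := eqVneq f 0.
  move: hf; rewrite f0 size_poly0 leqn0 size_poly_eq0.
  by rewrite (negPf (monic_neq0 hm)).
pose s := lead_coef f *: 'X^(size f - size h).
have sS : s \is a polyOver S by rewrite polyOverZ ?polyOverXn // (polyOverP fS).
have h0 : (0 < size h)%N by rewrite size_poly_gt0 monic_neq0.
have szf : (0 < size f)%N by rewrite size_poly_gt0.
case: (IHn (f - s * h)); last 1 first.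
- move=> q [r [e rS rh]]; exists (q + s), r; split=> //.
  by rewrite mulrDl addrAC -e subrK.
- suff lt : (size (f - s * h)%R < size f)%N by apply: leq_trans lt _.
  rewrite -[X in (_ < X)%N](prednK szf) ltnS; apply/leq_sizeP => j.
  rewrite leq_eqVlt => /predU1P[<-|jf].
    (* At index [size f - 1] the two terms cancel because [h] is monic. *)
    rewrite coefB -/(lead_coef f) /s -scalerAl coefZ coefXnM.
    have -> : ((size f).-1 < size f - size h)%N = false.
      by apply/negbTE; rewrite -leqNgt -subn1 leq_sub2l.
    have -> : ((size f).-1 - (size f - size h) = (size h).-1)%N.
      by rewrite -[in LHS]subn1 subnAC subKn // subn1.
    by rewrite -/(lead_coef h) (monicP hm) mulr1 subrr.
  rewrite prednK // in jf.
  rewrite coefB (nth_default _ jf) /s -scalerAl coefZ coefXnM.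
  case: ltnP => [_|_]; first by rewrite mulr0 subrr.
  rewrite [h`_ _]nth_default ?mulr0 ?subrr // leq_subRL.
    by rewrite subnK.
  by rewrite (leq_trans (leq_subr _ _)).
- by rewrite rpredB // rpredM.
Qed.

Lemma common_denominator (F : fieldType) (S : subringClosed F) (s : seq F) :
  (forall x, exists a b, [/\ a \in S, b \in S, b != 0 & x = a / b]) ->
  exists c, [/\ c \in S, c != 0 & {in s, forall x, c * x \in S}].
Proof.
move=> frac; elim: s => [|x s [c [cS c0 cs]]].
  by exists 1; rewrite rpred1 oner_neq0.
have [a [b [aS bS b0 xE]]] := frac x.
exists (c * b); split; [by rewrite rpredM | by rewrite mulf_neq0 |].
move=> y; rewrite in_cons => /predU1P[->|ys].
  by rewrite xE -mulrA (mulrC b) divfK // rpredM.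
by rewrite mulrAC rpredM // cs.
Qed.

(** Take a nonzero member of least size and divide it by its leading coefficient. *)
Lemma minimal_monic (F : fieldType) (I : set {poly F}) :
  (forall c g, I g -> I (c *: g)) ->
  (exists2 g, I g & g != 0) ->
  exists g, [/\ I g, g \is monic &
    forall f, I f -> (size f < size g)%N -> f = 0].
Proof.
move=> IZ [g0 Ig0 g00].
pose P n := `[< exists g, [/\ I g, g != 0 & size g = n] >].
have exP : exists n, P n by exists (size g0); apply/asboolP; exists g0.
case: (ex_minnP exP) => _ /asboolP[g [Ig gN0 <-]] min.
have lc0 : (lead_coef g)^-1 != 0 by rewrite invr_eq0 lead_coef_eq0.
exists ((lead_coef g)^-1 *: g); split; first exact: IZ.
  by rewrite monicE lead_coefZ mulVf // lead_coef_eq0.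
move=> f If; rewrite size_scale // ltnNge => /negP sfg.
apply/eqP; apply: contra_notT sfg => f0.
by apply: min; apply/asboolP; exists f.
Qed.

(** * Constants in the ring generated by a scaled element *)

Section Adjoin.
Variables (F : fieldType) (S : subringClosed F) (I : set {poly F}).
Hypothesis IB : forall p q, I p -> I q -> I (p - q).
Hypothesis IM : forall f p, I p -> I (f * p).

(* The preimage in [F[X]] of [S[c x]], where [x] is the class of ['X] modulo [I]. *)
Definition scaled_adjoin (c : F) : set {poly F} :=
  [set p | exists2 f, f \is a polyOver S & I (p - (f \Po (c *: 'X)))].

Lemma subring_scaled_adjoin c : I 0 -> subring_closed (mem (scaled_adjoin c)).
Proof.
move=> I0; have IN p : I p -> I (- p) by move=> Ip; rewrite -sub0r; exact: IB.
have ID p q : I p -> I q -> I (p + q).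
  by move=> Ip Iq; rewrite -[q]opprK; apply: IB => //; exact: IN.
apply/subring_closedP; split.
- by exists 1; [exact: rpred1|rewrite rmorph1 subrr].
- move=> p q [f fS If] [g gS Ig]; exists (f - g); first exact: rpredB.
  rewrite rmorphB.
  have -> : p - q - ((f \Po (c *: 'X)) - (g \Po (c *: 'X))) =
    p - (f \Po (c *: 'X)) - (q - (g \Po (c *: 'X))).
    by move: (f \Po _) (g \Po _) => u v; ring.
  exact: IB.
- move=> p q [f fS If] [g gS Ig]; exists (f * g); first exact: rpredM.
  rewrite rmorphM.
  have -> : p * q - (f \Po (c *: 'X)) * (g \Po (c *: 'X)) =
    q * (p - (f \Po (c *: 'X))) + (f \Po (c *: 'X)) * (q - (g \Po (c *: 'X))).
    by move: (f \Po _) (g \Po _) => u v; ring.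
  by apply: ID; exact: IM.
Qed.

(* If [c] clears the denominators of the minimal polynomial of [x], then [c x] is
   integral over [S] of degree [n >= 2], so [1, c x, ..., (c x)^(n-1)] is a basis
   of [S[c x]] over [S] and a constant of [S[c x]] already lies in [S]. *)
Lemma scaled_adjoin_avoids (b : F) :
  (forall x, exists a d, [/\ a \in S, d \in S, d != 0 & x = a / d]) ->
  (forall p, I p -> (size p <= 2)%N -> p = 0) ->
  b \notin S -> exists2 c, c != 0 & ~ scaled_adjoin c b%:P.
Proof.
move=> frac I2 bS.
(* If [I] has no nonzero member, ['X] satisfies no relation and [c = 1] already works. *)
have [Inz|Iz] := pselect (exists2 g, I g & g != 0); last first.
  exists 1; first exact: oner_neq0.
  move=> [f fS]; rewrite scale1r comp_polyXr => Ibf.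
  have /eqP : b%:P - f = 0.
    by apply/eqP; apply: contra_notT Iz => ?; exists (b%:P - f).
  rewrite subr_eq0 => /eqP fE; move: fS; rewrite -fE polyOverC.
  by apply/negP.
have IZ a p : I p -> I (a *: p) by rewrite -mul_polyC; exact: IM.
have [g [Ig gm gmin]] := minimal_monic IZ Inz.
have [c [cS c0 cg]] := common_denominator g frac.
exists c => // -[f fS Ibf].
have g0 : g != 0 by rewrite monic_neq0.
pose n := (size g).-1.
have gn : size g = n.+1 by rewrite prednK // size_poly_gt0.
(* With [x] the class of ['X], this is the minimal polynomial of [c x]: [g] evaluated at ['X / c]
   and made monic again. *)
pose h := c ^+ n *: (g \Po (c^-1 *: 'X)).
have hc i : h`_i = c ^+ n * c ^- i * g`_i.
  by rewrite coefZ coef_comp_scaleX exprVn mulrA.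
have hn : h`_n = 1.
  by rewrite hc divff ?expf_neq0 // mul1r -(monicP gm) lead_coefE.
have szh : size h = n.+1.
  apply/eqP; rewrite eqn_leq; apply/andP; split.
    by apply/leq_sizeP => j nj; rewrite hc [g`__]nth_default ?mulr0 // gn.
  by rewrite ltnNge; apply/negP => /leq_sizeP/(_ n (leqnn _))/eqP; rewrite hn oner_eq0.
have hm : h \is monic by rewrite monicE lead_coefE szh hn.
have hS : h \is a polyOver S.
  apply/polyOverP => i; case: (ltngtP i n) => [lt_in|lt_ni|->].
  (* For [i < n] the coefficient equals [c^(n-i-1) * (c * g_i)], and [c] was chosen with [c * g_i]
     in [S]. *)
  - rewrite hc -(subnK lt_in) exprD exprS -!mulrA [c ^+ i * _]mulrA.
    rewrite mulfV ?expf_neq0 // mul1r rpredM ?rpredX // cg // mem_nth //.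
    by rewrite gn ltnW.
  - by rewrite nth_default ?rpred0 // szh.
  - by rewrite hn rpred1.
have hcX : h \Po (c *: 'X) = c ^+ n *: g.
  apply/polyP => i; rewrite coef_comp_scaleX hc coefZ mulrA mulrCA.
  by rewrite mulfV ?expf_neq0 // mulr1.
have [q [r [fE rS rh]]] := polyOver_monic_rem hm hS fS.
have Ir : I (b%:P - (r \Po (c *: 'X))).
  have -> : b%:P - (r \Po (c *: 'X)) =
      b%:P - (f \Po (c *: 'X)) - (- (q \Po (c *: 'X))) * (c ^+ n *: g).
    by rewrite fE rmorphD rmorphM /= hcX mulNr opprK opprD addrA addrAC addrNK.
  by apply: IB => //; apply: IM; apply: IZ.
have szg : (2 < size g)%N.
  by rewrite ltnNge; apply/negP => /(I2 _ Ig)/eqP; rewrite (negPf g0).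
(* Since [r] has degree below [n] and [n >= 2], this member of [I] is too short to be nonzero; its
   constant term then gives [b = r_0]. *)
have lt : (size (b%:P - (r \Po (c *: 'X)))%R < size g)%N.
  rewrite gn ltnS; apply/leq_sizeP => j nj.
  rewrite coefB coefC coef_comp_scaleX nth_default; last first.
    by rewrite (leq_trans _ nj) // -ltnS -szh.
  have -> : j == 0 = false :> bool.
    by apply/gtn_eqF; rewrite (leq_trans _ nj) // -ltnS -gn ltnW.
  by rewrite mulr0 subrr.
have /(congr1 (fun p : {poly F} => p`_0)) := gmin _ Ir lt.
rewrite coefB coefC coef_comp_scaleX expr0 mul1r coef0 => /eqP.
rewrite subr_eq0 => /eqP br; move: bS; rewrite br.
by rewrite (polyOverP rS).
Qed.

End Adjoin.

(** * Relations over a local ring and the valuation property *)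

Section LocalSubring.
Variables (T : comUnitRingType) (K k : fieldType).
Variables (iota : {rmorphism T -> K}) (phi : {rmorphism T -> k}).
Hypothesis phi_surj : forall c, exists a, phi a = c.
Hypothesis phi_unit : forall a, phi a != 0 -> a \is a GRing.unit.

Local Notation ev x P := (map_poly iota P).[x].

Let evB x P Q : ev x (P - Q) = ev x P - ev x Q.
Proof. by rewrite rmorphB hornerD hornerN. Qed.
Let evM x P Q : ev x (P * Q) = ev x P * ev x Q.
Proof. by rewrite rmorphM hornerM. Qed.
Let evC x a : ev x a%:P = iota a.
Proof. by rewrite map_polyC hornerC. Qed.

Let evMXaddC x P a : ev x (P * 'X + a%:P) = ev x P * x + iota a.
Proof. by rewrite rmorphD rmorphM /= map_polyX map_polyC hornerMXaddC. Qed.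

Lemma lift_poly (f : {poly k}) : exists P, map_poly phi P = f.
Proof.
elim/poly_ind: f => [|f c [P <-]]; first by exists 0; rewrite rmorph0.
have [a <-] := phi_surj c; exists (P * 'X + a%:P).
by rewrite rmorphD rmorphM /= map_polyX map_polyC.
Qed.

(** With [n] the degree of [P], the relation [Q] multiplied by [x^n] expresses [x^n * (1 - q_0)]
    through lower powers of [x]. As [1 - q_0] is a unit, this eliminates the top term of [P], and
    all coefficients stay in the kernel of [phi]. *)
Lemma reduce_relation (x : K) (P Q : {poly T}) :
  x != 0 -> (size Q <= size P)%N -> map_poly phi P = 0 -> map_poly phi Q = 0 ->
  ev x P = 1 -> ev x^-1 Q = 1 ->
  exists P' : {poly T}, [/\ (size P' < size P)%N, map_poly phi P' = 0 & ev x P' = 1].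
Proof.
move=> x0 szQ P0 Q0 Px Qx.
have phiP i : phi P`_i = 0 by rewrite -coef_map P0 coef0.
have phiQ i : phi Q`_i = 0 by rewrite -coef_map Q0 coef0.
have Pn0 : P != 0.
  by apply/eqP => P00; move/eqP: Px; rewrite P00 rmorph0 horner0 eq_sym oner_eq0.
pose n := (size P).-1.
have Pn : size P = n.+1 by rewrite prednK // size_poly_gt0.
have u1 : 1 - Q`_0 \is a GRing.unit.
  by apply: phi_unit; rewrite rmorphB rmorph1 phiQ subr0 oner_eq0.
pose v := (1 - Q`_0)^-1.
have vE : iota v * (1 - iota Q`_0) = 1.
  by rewrite -(rmorph1 iota) -rmorphB -rmorphM mulVr.
exists (\poly_(i < n) (P`_i + P`_n * v * Q`_(n - i))); split.
- by rewrite Pn ltnS size_poly.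
- apply/polyP => i; rewrite coef_map /= coef_poly coef0.
  by case: ifP => _; rewrite ?rmorph0 // rmorphD !rmorphM !phiP !mul0r addr0.
have szm (R : {poly T}) : (size R <= n.+1)%N -> (size (map_poly iota R) <= n.+1)%N.
  by move=> ?; rewrite (leq_trans (size_poly _ _)).
(* This is [Q(x^-1) = 1] multiplied by [x^n], with the index reversed. *)
have Qsum : \sum_(i < n) iota Q`_(n - i) * x ^+ i = x ^+ n * (1 - iota Q`_0).
  move: Qx; rewrite (@horner_coef_wide _ n.+1) ?szm -?{1}Pn // big_ord_recl /=.
  rewrite coef_map expr0 mulr1 => <-; rewrite [_ + \sum_(_ < _) _]addrC addrK.
  rewrite big_distrr (reindex_inj rev_ord_inj); apply: eq_bigr => i _ /=.
  rewrite coef_map /= /bump add1n subKn // mulrCA; congr (_ * _).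
  by rewrite -[X in _ = x ^+ X * _](subnK (ltn_ord i)) exprD exprVn mulfK // expf_neq0.
rewrite (@horner_coef_wide _ n) ?(leq_trans (size_poly _ _) (size_poly _ _)) //.
under eq_bigr => i _ do
  rewrite coef_map /= coef_poly ltn_ord rmorphD !rmorphM /= mulrDl -[_ * _ * _ * _]mulrA.
rewrite big_split /= -big_distrr Qsum /=.
have -> : iota P`_n * iota v * (x ^+ n * (1 - iota Q`_0)) = iota P`_n * x ^+ n.
  by rewrite mulrACA vE mulr1.
rewrite -[RHS]Px (horner_coef_wide _ (szm P _)) ?Pn // big_ord_recr /= coef_map.
by congr (_ + _); apply: eq_bigr => i _; rewrite coef_map.
Qed.

(* Two relations [1 \in m T[x]] and [1 \in m T[x^-1]] of minimal total degree
   would contradict each other: the one of lower degree reduces the other. *)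
Lemma relations_exclusive (x : K) (P Q : {poly T}) :
  x != 0 -> map_poly phi P = 0 -> map_poly phi Q = 0 ->
  ev x P = 1 -> ev x^-1 Q = 1 -> False.
Proof.
have [n] := ubnP (size P + size Q); elim: n x P Q => // n IHn x P Q.
rewrite ltnS => szn x0 P0 Q0 Px Qx.
have [szQP|/ltnW szPQ] := leqP (size Q) (size P).
  have [P' [szP' P'0 P'x]] := reduce_relation x0 szQP P0 Q0 Px Qx.
  apply: (IHn x P' Q) => //; apply: leq_trans szn.
  by rewrite ltn_add2r.
have x'0 : x^-1 != 0 by rewrite invr_eq0.
have Px' : ev x^-1^-1 P = 1 by rewrite invrK.
have [Q' [szQ' Q'0 Q'x]] := reduce_relation x'0 szPQ Q0 P0 Qx Px'.
apply: (IHn x P Q') => //; apply: leq_trans szn.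
by rewrite ltn_add2l.
Qed.

(* With [A] the constants of [B] this is [D + m T[x]]; with [A] the preimage of
   [B[c x]] it is [D[c x] + m]. *)
Definition adjoined (x : K) (A : set {poly k}) : set K :=
  [set y | exists2 P, A (map_poly phi P) & y = ev x P].

Lemma subring_adjoined x (A : set {poly k}) :
  subring_closed (mem A) -> subring (adjoined x A).
Proof.
move=> /subring_closedP[A1 AB AM]; apply/subring_closedP; split.
- by exists 1; rewrite rmorph1 ?hornerC.
- move=> _ _ [P AP ->] [Q AQ ->]; exists (P - Q); rewrite ?evB //.
  by rewrite rmorphB; exact: AB.
- move=> _ _ [P AP ->] [Q AQ ->]; exists (P * Q); rewrite ?evM //.
  by rewrite rmorphM; exact: AM.
Qed.

Variables (B : set k) (a0 : T).
Hypothesis B_subring : subring B.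
Hypothesis B_frac : forall c, exists a b, [/\ B a, B b, b != 0 & c = a / b].
Hypothesis Ba0 : ~ B (phi a0).
Local Notation D := (iota @` (phi @^-1` B)).
Hypothesis D_max : forall A : set K, subring A -> D `<` A -> A (iota a0).

(** The adjoined ring contains [D]; if it were larger, maximality would put the excluded element
    [iota a0] in it. *)
Lemma adjoined_sub x (A : set {poly k}) :
  subring_closed (mem A) -> (forall b, B b -> A b%:P) ->
  ~ adjoined x A (iota a0) -> adjoined x A `<=` D.
Proof.
move=> Asub BA nA; apply: contrapT => nAD; apply: nA.
apply: D_max; first exact: subring_adjoined.
split=> // _ [t Bt <-]; exists t%:P; last by rewrite evC.
by rewrite map_polyC; exact: BA.
Qed.

Lemma kernel_stable (x : K) :
  ~ range iota x^-1 ->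
  ~ (exists2 P, map_poly phi P = 0 & ev x P = 1) ->
  forall a, phi a = 0 -> exists2 b, phi b = 0 & iota a * x = iota b.
Proof.
move=> x'T nrel a a0'.
have [B1 BB _] := (subring_closedP B).1 B_subring.
have BD : adjoined x (polyC @` B) `<=` D.
  apply: adjoined_sub.
  - exact: subring_image.
  - by move=> b Bb; exists b.
  - move=> [P [b Bb bP] Px]; have [b' b'E] := phi_surj b.
    have u : a0 - b' \is a GRing.unit.
      by apply: phi_unit; rewrite rmorphB /= b'E subr_eq0; apply/eqP => e;
        apply: Ba0; rewrite e.
    (* Dividing [P - b'] by the unit [a0 - b'] turns an expression of [a0] into a relation with
       value 1. *)
    apply: nrel; exists ((a0 - b')^-1%:P * (P - b'%:P)).
      by rewrite rmorphM rmorphB /= -bP !map_polyC /= b'E subrr mulr0.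
    by rewrite evM evB !evC -Px -rmorphB -rmorphM mulVr ?rmorph1.
have [b _ bE] : D (iota a * x).
  apply: BD; exists (a%:P * 'X); last by rewrite evM evC map_polyX hornerX.
  exists 0; first by rewrite -(subrr 1); exact: BB.
  by rewrite rmorphM /= map_polyC /= a0' mul0r.
(* If [b = a x] were a unit of [T], then [x^-1 = a / b] would lie in [T]. *)
exists b => //; apply/eqP; apply: contra_notT x'T => /phi_unit bu.
exists (a * b^-1) => //; rewrite rmorphM.
have b0 : iota b != 0 by rewrite -unitfE rmorph_unit.
rewrite rmorphV //; apply: (mulIf b0); rewrite divfK // bE.
have [x0|x0] := eqVneq x 0; last by rewrite mulrCA mulVf // mulr1.
by move: b0; rewrite bE x0 mulr0 eqxx.
Qed.

(* When [x] stabilizes the maximal ideal [m = ker phi], this is the kernel of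
   the evaluation [k[X] -> T[x] / m]. *)
Definition relation_ideal (x : K) : set {poly k} :=
  [set f | exists P, exists2 a, map_poly phi P = f & phi a = 0 /\ ev x P = iota a].

Section Stable.
Variable x : K.
Hypothesis stable : forall a, phi a = 0 -> exists2 b, phi b = 0 & iota a * x = iota b.
Hypothesis xT : ~ range iota x.

Lemma stable_ev P a : phi a = 0 -> exists2 b, phi b = 0 & ev x P * iota a = iota b.
Proof.
move=> a0'; elim/poly_ind: P => [|P c [b b0 bE]].
  by exists 0; rewrite ?rmorph0 // horner0 mul0r.
have [d d0 dE] := stable b0; exists (d + c * a).
  by rewrite rmorphD rmorphM a0' d0 mulr0 addr0.
by rewrite evMXaddC mulrDl mulrAC bE dE rmorphD rmorphM.
Qed.

(** Horner's scheme stays in [m] because [x] stabilizes [m]; thus [m T[x] = m]. *)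
Lemma ev_kernel P : map_poly phi P = 0 -> exists2 b, phi b = 0 & ev x P = iota b.
Proof.
elim/poly_ind: P => [|P c IHP].
  by exists 0; rewrite ?rmorph0 // horner0.
rewrite rmorphD rmorphM /= map_polyX map_polyC => PE.
have P0 : map_poly phi P = 0.
  by apply/polyP => i; move/(congr1 (fun p : {poly k} => p`_i.+1)): PE;
    rewrite coefD coefMX coefC addr0 !coef0.
have c0 : phi c = 0.
  by move/(congr1 (fun p : {poly k} => p`_0)): PE; rewrite coefD coefMX coefC add0r coef0.
have [b b0 bE] := IHP P0; have [d d0 dE] := stable b0.
exists (d + c); first by rewrite rmorphD d0 c0 addr0.
by rewrite evMXaddC bE dE rmorphD.
Qed.

Lemma relation_idealB p q :
  relation_ideal x p -> relation_ideal x q -> relation_ideal x (p - q).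
Proof.
move=> [P [a <- [a0' Pa]]] [Q [b <- [b0 Qb]]]; exists (P - Q), (a - b).
  by rewrite rmorphB.
by rewrite evB Pa Qb !rmorphB a0' b0 subr0.
Qed.

Lemma relation_idealM f p : relation_ideal x p -> relation_ideal x (f * p).
Proof.
move=> [P [a <- [a0' Pa]]]; have [Q <-] := lift_poly f.
have [b b0 bE] := stable_ev Q a0'; exists (Q * P), b; first by rewrite rmorphM.
by rewrite evM Pa.
Qed.

(** By [ev_kernel], two lifts of the same polynomial have values differing by an element of [m], so
    the choice of lift is irrelevant. *)
Lemma relation_ideal_ker P : relation_ideal x (map_poly phi P) ->
  exists2 b, phi b = 0 & ev x P = iota b.
Proof.
move=> [Q [a QP [a0' Qa]]].
have [b b0 bE] : exists2 b, phi b = 0 & ev x (P - Q) = iota b.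
  by apply: ev_kernel; rewrite rmorphB /= QP subrr.
exists (a + b); first by rewrite rmorphD a0' b0 addr0.
by rewrite rmorphD -Qa -bE evB addrC subrK.
Qed.

(** The class of [x] lies outside [k]: in a relation [c1 x + c0] with value in [m], a unit [c1]
    would put [x] in [T]; otherwise [c1 x] is in [m], hence so is [c0]. *)
Lemma relation_ideal_size p :
  injective iota -> relation_ideal x p -> (size p <= 2)%N -> p = 0.
Proof.
move=> iota_inj Ip sp; have [c0 c0E] := phi_surj p`_0; have [c1 c1E] := phi_surj p`_1.
have pE : p = map_poly phi (c1%:P * 'X + c0%:P).
  rewrite rmorphD rmorphM /= map_polyX !map_polyC /= c0E c1E.
  apply/polyP => -[|[|i]]; rewrite coefD coefMX !coefC /= ?add0r ?addr0 //.
  by rewrite nth_default // (leq_trans sp).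
move: Ip; rewrite {1}pE => /relation_ideal_ker[b b0].
rewrite evMXaddC evC => bE.
have c10 : phi c1 = 0.
  apply/eqP; apply: contra_notT xT => /phi_unit c1u.
  exists (c1^-1 * (b - c0)) => //.
  by rewrite rmorphM rmorphB -bE addrK mulrA -rmorphM mulVr // rmorph1 mul1r.
have [d d0 dE] := stable c10.
have c00 : phi c0 = 0.
  have -> : c0 = b - d by apply: iota_inj; rewrite rmorphB /= -bE -dE addrAC subrr add0r.
  by rewrite rmorphB b0 d0 subrr.
by rewrite pE rmorphD rmorphM /= !map_polyC /= c00 c10 mul0r addr0.
Qed.

End Stable.

Hypothesis iota_inj : injective iota.

Lemma valuation_of_max (x : K) : x != 0 -> range iota x \/ range iota x^-1.
Proof.
move=> x0.
(* If [x] and [x^-1] were both outside [T], [main] would yield a relation for each, and such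
   relations exclude each other. *)
suff main y : ~ range iota y -> ~ range iota y^-1 ->
    exists2 P, map_poly phi P = 0 & ev y P = 1.
  apply: contrapT => /not_orP[xT x'T].
  have [P P0 Px] := main x xT x'T.
  have [Q Q0 Qx] : exists2 Q, map_poly phi Q = 0 & ev x^-1 Q = 1.
    by apply: main => //; rewrite invrK.
  exact: relations_exclusive x0 P0 Q0 Px Qx.
move=> yT y'T; apply: contrapT => nrel.
have stable := kernel_stable y'T nrel.
have B_closed : subring_closed (fun c : k => c \in B) by exact: B_subring.
pose S : subringClosed k := HB.pack (fun c : k => c \in B)
  (GRing.isSubringClosed.Build k (fun c => c \in B) B_closed).
have SB c : (c \in S) = (c \in B) by [].
have IB := @relation_idealB y.
have IM := relation_idealM stable.
have I2 p Ip := relation_ideal_size stable yT iota_inj (p := p) Ip.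
have fracS c : exists a b, [/\ a \in S, b \in S, b != 0 & c = a / b].
  by have [a [b [Ba Bb b0 cE]]] := B_frac c; exists a, b; rewrite !SB !in_setE.
have a0S : phi a0 \notin S by rewrite SB; apply/negP; rewrite in_setE.
have [c c0 nA] := scaled_adjoin_avoids IB IM fracS I2 a0S.
have I0 : relation_ideal y 0.
  by exists 0, 0; rewrite ?rmorph0 // horner0.
have [c' c'E] := phi_surj c.
have sub : adjoined y (scaled_adjoin S (relation_ideal y) c) `<=` D.
  apply: adjoined_sub; first exact: subring_scaled_adjoin.
  - move=> b Bb; exists b%:P; first by rewrite polyOverC SB in_setE.
    by rewrite comp_polyC subrr.
  - move=> [P [f fS If] Py]; apply: nA; exists f => //.
    (* As [P - a0] vanishes at [y], its reduction is a relation, so [phi a0] would lie in the scaled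
       ring. *)
    have -> : (phi a0)%:P - (f \Po (c *: 'X)) =
        map_poly phi P - (f \Po (c *: 'X)) - map_poly phi (P - a0%:P).
      by rewrite rmorphB /= map_polyC /=; move: (f \Po _) => u; ring.
    apply: IB => //; exists (P - a0%:P), 0 => //.
    by rewrite evB evC Py subrr !rmorph0.
(* The class of [c y] comes from [f = 'X]; its lift lies in [D], hence in [T], and dividing by the
   unit [c'] puts [y] in [T]. *)
have [|b _ bE] := sub (iota c' * y).
  exists (c'%:P * 'X); last by rewrite evM evC map_polyX hornerX.
  exists 'X; first exact: polyOverX.
  by rewrite rmorphM /= map_polyX map_polyC /= c'E comp_polyX mul_polyC subrr.
have c'u : c' \is a GRing.unit by apply: phi_unit; rewrite c'E.
apply: yT; exists (c'^-1 * b) => //.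
by rewrite rmorphM bE mulrA -rmorphM mulVr // rmorph1 mul1r.
Qed.

End LocalSubring.

(** * Maximal ideals, units of a local ring, fractions *)

Lemma idealr_of_set (R : nzRingType) (P : set R) :
  idealr_closed (fun x => x \in P) -> exists J : idealr R, forall x, x \in J <-> P x.
Proof.
move=> cl; pose Jm := isIdealr.Build R (fun x => x \in P) cl.
pose J : idealr R := HB.pack (fun x : R => x \in P) Jm.
by exists J => x; split=> [|Px]; [move/set_mem | exact/mem_set].
Qed.

Lemma idealr_setP (R : nzRingType) (J : idealr R) :
  idealr_closed (fun x => x \in [set y | y \in J]).
Proof.
split; rewrite ?in_setE /= ?idealr0 //.
  by apply/negP; rewrite in_setE /= idealr1.
by move=> a u v; rewrite !in_setE /= => uJ vJ; rewrite rpredD ?idealMr.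
Qed.

Lemma ideal_sub_maximal (R : comNzRingType) (J0 : idealr R) :
  exists J : idealr R, maximal_ideal J /\ {subset J0 <= J}.
Proof.
(* Zorn's lemma is applied to subsets of [R], since [idealr R] lives in a
   universe that is too large for [ZL_preorder]. *)
pose X := {A : set R | idealr_closed (fun x => x \in A) /\ forall x, x \in J0 -> A x}.
pose le (A B : X) : bool := `[< sval A `<=` sval B >].
have leP A B : le A B -> sval A `<=` sval B by move/asboolP.
pose X0 : X := exist _ [set x | x \in J0] (conj (idealr_setP J0) (fun _ => id)).
have [//|||[A [Ac AJ0]] Amax] := @ZL_preorder X X0 le.
- by move=> A; apply/asboolP.
- by move=> A B C /leP AB /leP BC; apply/asboolP => x /AB/BC.
(* An empty chain is bounded by [X0]; a nonempty one by its union, where any two elements already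
   lie in a common member. *)
- move=> C Ctot; have [[N CN]|C0] := pselect (exists N, C N); last first.
    by exists X0 => s Cs; case: C0; exists s.
  pose U : set R := [set x | exists2 L, C L & sval L x].
  have Uc : idealr_closed (fun x => x \in U).
    split.
    - rewrite in_setE; exists N => //; case: (svalP N) => -[+ _ _] _.
      by rewrite in_setE.
    - apply/negP; rewrite in_setE => -[L _]; case: (svalP L) => -[_ + _] _.
      by move=> /negP; rewrite in_setE.
    - have closed (L : X) a u v : sval L u -> sval L v -> sval L (a * u + v).
        case: (svalP L) => -[_ _ /(_ a u v) +] _.
        by rewrite !in_setE; apply.
      move=> a u v; rewrite !in_setE => -[L CL uL] [M CM vM].
      have [/leP LM|/leP ML] := Ctot _ _ CL CM.
        by exists M => //; apply: closed => //; exact: LM.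
      by exists L => //; apply: closed => //; exact: ML.
  have J0U x : x \in J0 -> U x.
    by move=> xJ0; exists N => //; case: (svalP N) => _; exact.
  exists (exist _ U (conj Uc J0U)) => L CL; apply/asboolP => x xL /=.
  by exists L.
have [J JA] := idealr_of_set Ac; exists J; split=> [L JL|x /AJ0/JA//].
have J0L x : x \in J0 -> [set x | x \in L] x by move=> /AJ0/JA/JL.
have /Amax/leP LA : le (exist _ A (conj Ac AJ0)) (exist _ _ (conj (idealr_setP L) J0L)).
  by apply/asboolP => x /JA/JL.
by move=> x xL; apply/JA/LA.
Qed.

(** A non-unit generates a proper ideal, which lies in a maximal ideal, and that ideal can only be
    [m]. *)
Lemma local_ring_unit (R : comUnitRingType) (m : idealr R) (a : R) :
  local_ring m -> a \notin m -> a \is a GRing.unit.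
Proof.
move=> [_ muniq]; apply: contraR => aU.
have [|J Ja] := @idealr_of_set R [set x | exists c, x = c * a].
  split.
  - by rewrite in_setE; exists 0; rewrite mul0r.
  - apply/negP; rewrite in_setE => -[c ca]; move/negP: aU; apply.
    by apply/unitrPr; exists c; rewrite mulrC.
  - move=> b u v; rewrite !in_setE => -[c ->] [d ->]; exists (b * c + d).
    by rewrite mulrDl mulrA.
have [L [Lmax JL]] := ideal_sub_maximal J.
by rewrite -(muniq L Lmax) JL //; apply/Ja; exists 1; rewrite mul1r.
Qed.

Lemma fraction_of_ratio (R : idomainType) (x : {fraction R}) :
  exists a b, b != 0 /\ x = FracField.tofrac a / FracField.tofrac b.
Proof.
elim/quotW: x => r; exists (\n_r), (\d_r); split; first exact: denom_ratioP.
have d0 : FracField.tofrac \d_r != 0 by rewrite tofrac_eq0 denom_ratioP.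
(* With the denominator cleared, two classes of pairs are compared by cross multiplication. *)
apply: (mulIf d0); rewrite divfK //; unlock FracField.tofrac.
rewrite -[LHS]FracField.pi_mul; apply/eqP; rewrite FracField.equivf_def.
rewrite /FracField.mulf !numden_Ratio ?mulf_neq0 ?oner_neq0 ?denom_ratioP //.
by rewrite !mulr1 mulrC.
Qed.

(** * Transfer between [B] and its pullback [D] *)

Section Pullback.
Variables (T : idomainType) (k : fieldType) (phi : {rmorphism T -> k}).
Hypothesis phi_surj : forall c, exists a, phi a = c.
Hypothesis phi_unit : forall a, phi a != 0 -> a \is a GRing.unit.
Variable B : set k.
Hypothesis B_subring : subring B.
Hypothesis B_frac : quotient_field B = [set: k].
Local Notation iota := (@FracField.tofrac T).
Local Notation D := (iota @` (phi @^-1` B)).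

Let fracB c : exists a b, [/\ B a, B b, b != 0 & c = a / b].
Proof. by have : quotient_field B c by rewrite B_frac. Qed.

Let iota_inj : injective iota.
Proof. by move=> a b /eqP; rewrite tofrac_eq => /eqP. Qed.

Let DP a : D (iota a) <-> B (phi a).
Proof. by split=> [[b Bb /iota_inj <-]|Ba] //; exists a. Qed.

(** Lifting a denominator of [phi a] gives a nonzero element of [D] that multiplies [a] into [D];
    doing this for numerator and denominator rewrites any fraction over [D]. *)
Lemma quotient_field_pullback : quotient_field D = [set: {fraction T}].
Proof.
have den a : exists b, [/\ D (iota b), b != 0 & D (iota (b * a))].
  have [b1 [b2 [Bb1 Bb2 b20 ab]]] := fracB (phi a).
  have [d dE] := phi_surj b2; exists d; split.
  - by apply/DP; rewrite dE.
  - by apply: contra_neq b20 => d0; rewrite -dE d0 rmorph0.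
  - by apply/DP; rewrite rmorphM dE ab mulrC divfK.
have [_ _ BM] := (subring_closedP B).1 B_subring.
rewrite -subTset => x _; have [a [b [b0 ->]]] := fraction_of_ratio x.
have [c [Dc c0 Dca]] := den a; have [d [Dd d0 Ddb]] := den b.
exists (iota (d * (c * a))), (iota (c * (d * b))); split.
- by apply/DP; rewrite rmorphM; apply: BM; exact/DP.
- by apply/DP; rewrite rmorphM; apply: BM; exact/DP.
- by rewrite tofrac_eq0 !mulf_neq0.
- have -> : d * (c * a) = c * d * a by rewrite mulrCA mulrA.
  rewrite !mulrA (rmorphM _ _ a) (rmorphM _ _ b) -mulf_div divff ?mul1r //.
  by rewrite tofrac_eq0 mulf_neq0.
Qed.

Lemma maximal_excluding_residue :
  B <> [set: k] -> maximal_excluding D -> maximal_excluding B /\ valuation_domain T.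
Proof.
move=> BT [alpha [_ aD] Dmax].
have Dmax' A : subring A -> D `<` A -> A alpha.
  move=> Asub DA; apply: Dmax => //; split=> //; first exact: properW.
  by rewrite quotient_field_pullback.
(* Since [B] is not all of [k], [T] strictly contains [D], so it contains [alpha]. *)
have [a _ aE] : range iota alpha.
  apply: Dmax'; first by apply: subring_image; apply/subring_closedP.
  split; first by move=> _ [x _ <-]; exists x.
  move=> TD; apply: BT; rewrite -subTset => c _.
  by have [x <-] := phi_surj c; apply/DP/TD; exists x.
have Ba : ~ B (phi a) by move/DP; rewrite aE.
split; last first.
  move=> x; apply: (valuation_of_max phi_surj phi_unit B_subring fracB Ba _ iota_inj).
  by move=> A Asub DA; rewrite /= aE; exact: Dmax'.
exists (phi a); first by split=> //; rewrite B_frac.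
move=> A [Asub BA _] [_ nAB].
have : (iota @` (phi @^-1` A)) alpha.
  apply: Dmax'; first exact/subring_image/subring_preimage.
  split; first by move=> _ [x /BA Ax <-]; exists x.
  move=> sub; apply: nAB => c; have [x <-] := phi_surj c => Ac.
  by apply/DP/sub; exists x.
by rewrite -aE => -[b Ab /iota_inj <-].
Qed.

Lemma maximal_excluding_pullback :
  maximal_excluding B -> valuation_domain T -> maximal_excluding D.
Proof.
move=> [beta [_ Bb] Bmax] Tval; have [a aE] := phi_surj beta.
have [B1 BB _] := (subring_closedP B).1 B_subring.
have B0 : B 0 by rewrite -(subrr 1); exact: BB.
exists (iota a); first by split; [rewrite quotient_field_pullback | move/DP; rewrite aE].
move=> A [Asub DA _] [_ nAD]; have [A1 AB AM] := (subring_closedP A).1 Asub.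
have Am t : phi t = 0 -> A (iota t) by move=> t0; apply: DA; apply/DP; rewrite t0.
(* An [x] in [A] outside [T] has its inverse [y] in [m], and [a = x * (y a)] with [y a] in [m], a
   subset of [D]. *)
have [AT|/existsNP[x /not_implyP[Ax xT]]] := pselect (A `<=` range iota); last first.
  have x0 : x != 0 by apply: contra_notN xT => /eqP ->; exists 0; rewrite ?rmorph0.
  have [//|[y _ yE]] := Tval x x0.
  have y0 : phi y = 0.
    apply/eqP; apply: contra_notT xT => /phi_unit yu; exists y^-1 => //.
    by rewrite rmorphV // /= yE invrK.
  have -> : iota a = x * iota (y * a) by rewrite rmorphM /= yE mulVKf.
  by apply: AM => //; apply: Am; rewrite rmorphM y0 mul0r.
(* When [A] lies in [T], its image strictly contains [B]: [A] contains [m], so an element of [A]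
   with residue [beta] differs from [a] by an element of [A]. *)
have [b Ab bE] : [set phi b | b in iota @^-1` A] beta.
  apply: Bmax.
    split; last by rewrite B_frac.
      exact/subring_image/subring_preimage.
    by move=> c; have [x <-] := phi_surj c => Bx; exists x => //; apply/DA/DP.
  split.
    by move=> c; have [x <-] := phi_surj c => Bx; exists x => //; apply/DA/DP.
  move=> sub; apply: nAD => x Ax; have [t _ tE] := AT _ Ax.
  by rewrite -tE; apply/DP/sub; exists t => //=; rewrite tE.
have -> : iota a = iota b - iota (b - a) by rewrite -rmorphB opprB addrC subrK.
by apply: AB => //; apply: Am; rewrite rmorphB aE bE subrr.
Qed.

End Pullback.

Theorem theorem3p1 (T : idomainType) (m : idealr T) (Tlocal : local_ring m)
    (B : set (residue_field (proj1 Tlocal)))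
    (B_subring : subring B)
    (B_quot : quotient_field B = [set: residue_field (proj1 Tlocal)])
    (B_proper : B <> [set: residue_field (proj1 Tlocal)]) :
  let phi : T -> residue_field (proj1 Tlocal) := @residue T m (proj1 Tlocal) in
  let D : set {fraction T} := @tofrac T @` (phi @^-1` B) in
  maximal_excluding D <-> maximal_excluding B /\ valuation_domain T.
Proof.
move=> phi D.
have phi_surj c : exists a, phi a = c by exact: residue_surj.
have phi_unit a : phi a != 0 -> a \is a GRing.unit.
  by rewrite residue_eq0; exact: local_ring_unit.
split=> [|[]].
  exact: maximal_excluding_residue.
exact: maximal_excluding_pullback.
Qed.
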